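(* Let $\mathscr S=\langle E,S,F,N,g,s\rangle$ be a logical system with respect to $P$ and $T$. Then: (i)(a) If $\mathscr S$ is self-referential with respect to $P$ and $g^*P$ is $P$-representable, then: if $\mathscr S$ is consistent, then $\mathscr S$ is incomplete. (i)(b) If $\mathscr S$ is self-referential with respect to $T$ and $g^*P$ is $T$-representable, then: if $\mathscr S$ is sound, then $\mathscr S$ is incomplete. (ii) If $\mathscr S$ is self-referential with respect to $T$, then $g^*T$ is not $T$-representable. (iii) If $\mathscr S$ is self-referential with respect to $P$, then $N\setminus g^*P$ is not $P$-representable.
   Context: An abstract formal system is a tuple $\langle E,S,F,N,g,s\rangle$ with: $\emptyset\neq S\subseteq F\subseteq E$, $N$ a set with $F\cap N=\emptyset$; $g$ a one-one map from $F$ onto $N$ with inverse $g^{-1}$, and $g^*H=\{g(\varphi):\varphi\in H\}$ for $H\subseteq F$; $s:F\times N\to S$ a map with $s(\sigma,n)=\sigma$ for all $\sigma\in S$, $n\in N$, written $\varphi[n]=s(\varphi,n)$. For $A\subseteq S$, a set $X\subseteq N$ is $A$-representable if there is $\varphi\in F$ with, for all $n\in N$: $n\in X$ iff $\varphi[n]\in A$. The system is self-referential with respect to $A$ if for every $A$-representable $X\subseteq N$, the set $\{n\in N: g(g^{-1}(n)[n])\in X\}$ is $A$-representable. A logical system with respect to $P$ and $T$ is an abstract formal system together with sets $P,T\subseteq S$ (provable and true sentences) such that for every $\varphi\in F$ there is $\varphi'\in F$ (the negation of $\varphi$) such that for every $n\in N$: (a) $\varphi[n]\in T$ iff $\varphi'[n]\notin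 T$; (b) $\varphi[n]\in P$ iff $\varphi''[n]\in P$ (where $\varphi''=(\varphi')'$). For $H\subseteq F$, $H'=\{\varphi\in F:\varphi'\in H\}$. The system is consistent if $P\cap P'=\emptyset$; complete if $P\cup P'=S$ (incomplete otherwise); sound if $P\subseteq T$.
   Formalization: Part (i)(a), false as literally stated, is proved under the added assumption that for all φ in F and n in N, φ[n] ∈ P' if and only if φ'[n] ∈ P (the negation of φ[n] is provable exactly when φ'[n] is). *)

(* Defs.v *)
From mathcomp Require Import all_boot.
From mathcomp Require Import boolp classical_sets functions.

Set Implicit Arguments.
Unset Strict Implicit.
Unset Printing Implicit Defensive.

Local Open Scope classical_set_scope.

(* E, S, F and N are subsets of one ambient type [U], so that F and N can be
   required to be disjoint.  The maps g, g^-1 and s are total on [U]; only their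
   values on F, on N and on F x N are constrained, and only those are used. *)
Record formal_system (U : Type) := FormalSystem {
  E_ : set U;
  S_ : set U;
  F_ : set U;
  N_ : set U;
  g_ : U -> U;
  ginv_ : U -> U;
  s_ : U -> U -> U;
  S_neq0 : S_ !=set0;
  S_sub_F : S_ `<=` F_;
  F_sub_E : F_ `<=` E_;
  F_N_disjoint : F_ `&` N_ = set0;
  g_bij : set_bij F_ N_ g_;
  ginv_F : forall n, N_ n -> F_ (ginv_ n);
  ginvK : forall n, N_ n -> g_ (ginv_ n) = n;
  s_S : forall phi n, F_ phi -> N_ n -> S_ (s_ phi n);
  s_id : forall sigma n, S_ sigma -> N_ n -> s_ sigma n = sigma
}.

Section FormalSystem.
Variables (U : Type) (L : formal_system U).

Definition gstar (H : set U) : set U := [set g_ L phi | phi in H].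

Definition representable (A X : set U) : Prop :=
  exists2 phi, F_ L phi & forall n, N_ L n -> (X n <-> A (s_ L phi n)).

Definition diagonal_set (X : set U) : set U :=
  [set n | N_ L n /\ X (g_ L (s_ L (ginv_ L n) n))].

Definition self_referential (A : set U) : Prop :=
  forall X, X `<=` N_ L -> representable A X -> representable A (diagonal_set X).

(* [neg phi] is the chosen negation phi'; it has to be an operation for
   phi'' = (phi')' to make sense. *)
Record logical_system (P T : set U) (neg : U -> U) : Prop := LogicalSystem {
  P_sub_S : P `<=` S_ L;
  T_sub_S : T `<=` S_ L;
  neg_F : forall phi, F_ L phi -> F_ L (neg phi);
  neg_T : forall phi n, F_ L phi -> N_ L n ->
    (T (s_ L phi n) <-> ~ T (s_ L (neg phi) n));
  neg_neg_P : forall phi n, F_ L phi -> N_ L n ->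
    (P (s_ L phi n) <-> P (s_ L (neg (neg phi)) n))
}.

Definition primed (neg : U -> U) (H : set U) : set U :=
  [set phi | F_ L phi /\ H (neg phi)].

Definition consistent (P : set U) (neg : U -> U) : Prop :=
  P `&` primed neg P = set0.

Definition complete (P : set U) (neg : U -> U) : Prop :=
  P `|` primed neg P = S_ L.

Definition incomplete (P : set U) (neg : U -> U) : Prop := ~ complete P neg.

Definition sound (P T : set U) : Prop := P `<=` T.

(* The convention that the sentence phi'[n] serves as the negation of the
   sentence phi[n], as far as provability is concerned: (phi[n])' is provable
   iff phi'[n] is.  The clauses of [logical_system] relate phi[n] to phi'[n]
   only through T, so they do not imply it, and without it consistency and
   completeness say nothing about the pair phi[n], phi'[n]. *)
Definition neg_instance (P : set U) (neg : U -> U) : Prop :=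
  forall phi n, F_ L phi -> N_ L n ->
    (primed neg P (s_ L phi n) <-> P (s_ L (neg phi) n)).

End FormalSystem.

(* Main.v *)
Require Import Defs.
From mathcomp Require Import all_boot.
From mathcomp Require Import boolp classical_sets functions.

Local Open Scope classical_set_scope.

(** Self-reference turns a formula representing X into a formula phi such that,
    for every formula psi, phi[g psi] is in A iff g(psi[g psi]) is in X.
    Taking psi = phi with X the complement of g^*A is contradictory, which gives
    (iii), and (ii) because negation makes T-representability stable under
    complement.  For (i)(a) take psi = phi' and X = g^*P: the sentence phi[g phi']
    is provable iff its negation is.  For (i)(b) take psi = phi and
    X = N \ g^*P: the sentence phi[g phi] is true iff it is not provable. *)

Section Diagonalization.
Set Implicit Arguments.
Unset Strict Implicit.
Variables (U : Type) (L : formal_system U).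

Lemma g_N phi : F_ L phi -> N_ L (g_ L phi).
Proof. by case: (g_bij L) => gFN _ _; apply: gFN. Qed.

Lemma ginv_g phi : F_ L phi -> ginv_ L (g_ L phi) = phi.
Proof.
move=> Fphi; have Ng := g_N Fphi.
case: (g_bij L) => _ g_inj _.
by apply: g_inj; rewrite ?inE ?ginvK//; exact: ginv_F.
Qed.

Lemma instance_F phi n : F_ L phi -> N_ L n -> F_ L (s_ L phi n).
Proof. by move=> Fphi Nn; apply: S_sub_F; apply: s_S. Qed.

(** Since A lies in S, hence in F, the injectivity of g on F applies. *)
Lemma gstar_g (A : set U) phi :
  A `<=` S_ L -> F_ L phi -> gstar L A (g_ L phi) <-> A phi.
Proof.
move=> AS Fphi; split=> [[psi Apsi gE]|Aphi]; last by exists phi.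
have Fpsi : F_ L psi by apply: S_sub_F; exact: AS.
by rewrite -(ginv_g Fphi) -gE ginv_g.
Qed.

Lemma diagonal_formula (A X : set U) :
    self_referential L A -> X `<=` N_ L -> representable L A X ->
  exists2 phi, F_ L phi & forall psi, F_ L psi ->
    (A (s_ L phi (g_ L psi)) <-> X (g_ L (s_ L psi (g_ L psi)))).
Proof.
move=> selfA XN /(selfA _ XN)[phi Fphi phiP].
exists phi => // psi Fpsi; have Ng := g_N Fpsi.
rewrite -(phiP _ Ng) /diagonal_set /= ginv_g //.
by split=> [[]|].
Qed.

(** Common core of three parts: A = T, B = P gives (i)(b), and A = B gives the contradiction behind
    (ii) and (iii). *)
Lemma diagonal_sentence_compl (A B : set U) :
    self_referential L A -> B `<=` S_ L ->
    representable L A (N_ L `\` gstar L B) ->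
  exists2 sigma, S_ L sigma & A sigma <-> ~ B sigma.
Proof.
move=> selfA BS /(diagonal_formula selfA (@subDsetl _ _ _))[phi Fphi phiP].
have Ng := g_N Fphi; have Fi := instance_F Fphi Ng.
exists (s_ L phi (g_ L phi)); first exact: s_S.
rewrite (phiP _ Fphi) -(gstar_g BS Fi).
by split=> [[]//|nB]; split=> //; exact: g_N.
Qed.

Lemma compl_gstar_not_representable (A : set U) :
    self_referential L A -> A `<=` S_ L ->
  ~ representable L A (N_ L `\` gstar L A).
Proof.
by move=> selfA AS /(diagonal_sentence_compl selfA AS)[sigma _]; tauto.
Qed.

Lemma representable_compl (P T X : set U) (neg : U -> U) :
    logical_system L P T neg -> representable L T X ->
  representable L T (N_ L `\` X).
Proof.
move=> HL [phi Fphi phiP]; exists (neg phi); first exact: (neg_F HL).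
move=> n Nn; have := phiP n Nn; have := neg_T HL Fphi Nn.
rewrite /setD /=; have := EM (T (s_ L (neg phi) n)); tauto.
Qed.

(** A sentence equals each of its instances, so the clause on phi[n] applies to [sigma] itself;
    [g_ L sigma] only supplies an element of N. *)
Lemma neg_sentence_not_T (P T : set U) (neg : U -> U) sigma :
    logical_system L P T neg -> S_ L sigma -> S_ L (neg sigma) ->
  T sigma -> ~ T (neg sigma).
Proof.
move=> HL Ssigma Sneg; have Fsigma := S_sub_F Ssigma.
have Ng := g_N Fsigma.
by have := neg_T HL Fsigma Ng; rewrite !s_id // => -[].
Qed.

End Diagonalization.

Theorem mainTheorem4 (U : Type) (L : formal_system U) (P T : set U)
    (neg : U -> U) (HL : logical_system L P T neg) :
  [/\ (self_referential L P -> representable L P (gstar L P) ->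
         neg_instance L P neg ->
         consistent L P neg -> incomplete L P neg),
      (self_referential L T -> representable L T (gstar L P) ->
         sound P T -> incomplete L P neg),
      (self_referential L T -> ~ representable L T (gstar L T)) &
      (self_referential L P -> ~ representable L P (N_ L `\` gstar L P))].
Proof.
have PS := P_sub_S HL; have TS := T_sub_S HL.
split.
- move=> selfP repP negI cons compl.
  have gPN : gstar L P `<=` N_ L.
    by move=> _ [psi Ppsi <-]; apply: g_N; apply: S_sub_F; exact: PS.
  have [phi Fphi phiP] := diagonal_formula selfP gPN repP.
  have Fn := neg_F HL Fphi; have Ng := g_N Fn.
  (* At psi = phi', with [negI], the sentence phi[g phi'] lies in both P and P' or in neither;
     consistency excludes the first, completeness the second. *)
  have := phiP _ Fn; rewrite (gstar_g PS (instance_F Fn Ng)).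
  rewrite -(negI _ _ Fphi Ng) => PP'.
  have disj : ~ (P `&` primed L neg P) (s_ L phi (g_ L (neg phi))).
    by rewrite cons.
  have : (P `|` primed L neg P) (s_ L phi (g_ L (neg phi))).
    by rewrite compl; exact: s_S.
  by move: disj; rewrite /setI /setU /=; tauto.
- move=> selfT /(representable_compl HL) repC snd compl.
  have [sigma Ssigma TnP] := diagonal_sentence_compl selfT PS repC.
  have nP : ~ P sigma by move=> Ps; have := snd _ Ps; tauto.
  have : (P `|` primed L neg P) sigma by rewrite compl.
  case=> [//|[_ Pneg]].
  (* [sigma] is true because it is unprovable, and its provable negation is true by soundness. *)
  by apply: (neg_sentence_not_T HL Ssigma (PS _ Pneg)); [tauto|exact: snd].
- move=> selfT /(representable_compl HL).
  exact: compl_gstar_not_representable.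
- by move=> selfP; exact: compl_gstar_not_representable.
Qed.
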